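(* Let $\mathsf{C}$ be a Markov category. The subcategory of deterministic morphisms $\mathsf{C}_{\mathrm{det}}\subseteq\mathsf{C}$ is closed under tensor product and contains all structure maps, meaning the associators, the unitors, and all $\mathsf{del}_X$, $\mathsf{copy}_X$ and $\mathsf{swap}_{X,Y}$.
   Context: A Markov category is a symmetric monoidal category $(\mathsf{C},\otimes,I)$ (not assumed strict) with symmetry $\mathsf{swap}_{X,Y}:X\otimes Y\to Y\otimes X$, in which every object $X$ is equipped with morphisms $\mathsf{copy}_X:X\to X\otimes X$ and $\mathsf{del}_X:X\to I$ forming a commutative comonoid (coassociative, counital, cocommutative, with respect to the associators, unitors and symmetry), such that: (i) $\mathsf{del}_{X\otimes Y}$ is $\mathsf{del}_X\otimes\mathsf{del}_Y$ followed by $I\otimes I\cong I$; (ii) $\mathsf{copy}_{X\otimes Y}$ is $\mathsf{copy}_X\otimes\mathsf{copy}_Y$ followed by the canonical isomorphism $(X\otimes X)\otimes(Y\otimes Y)\cong(X\otimes Y)\otimes(X\otimes Y)$ built from associators and the symmetry on the two middle factors; (iii) $\mathsf{del}_Y\circ f=\mathsf{del}_X$ for every $f:X\to Y$. A morphism $f:X\to Y$ is deterministic if $\mathsf{copy}_Y\circ f=(f\otimes f)\circ\mathsf{copy}_X$. Deterministic morphisms are closed under composition and contain the identities; $\mathsf{C}_{\mathrm{det}}$ denotes the resulting subcategory (with all objects of $\mathsf{C}$). *)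

(* Defs.v *)
From Corelib Require Import ssreflect.

Set Implicit Arguments.
Unset Strict Implicit.
Unset Printing Implicit Defensive.

Declare Scope cat_scope.
Delimit Scope cat_scope with cat.
Local Open Scope cat_scope.

Reserved Notation "X ~> Y" (at level 90, right associativity).
Reserved Notation "g ∘ f" (at level 50, left associativity).
Reserved Notation "X ⊗ Y" (at level 40, left associativity).
Reserved Notation "f ⊠ g" (at level 40, left associativity).
Reserved Notation "f ∈ D" (at level 70, no associativity).

Record category := Category {
  Ob :> Type;
  Hom : Ob -> Ob -> Type where "X ~> Y" := (Hom X Y) : cat_scope;
  idm : forall X, X ~> X;
  comp : forall X Y Z, (Y ~> Z) -> (X ~> Y) -> (X ~> Z)
    where "g ∘ f" := (comp g f) : cat_scope;
  comp_idl : forall X Y (f : X ~> Y), idm Y ∘ f = f;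
  comp_idr : forall X Y (f : X ~> Y), f ∘ idm X = f;
  compA : forall W X Y Z (h : Y ~> Z) (g : X ~> Y) (f : W ~> X),
    h ∘ (g ∘ f) = (h ∘ g) ∘ f
}.
Arguments idm {_} X.
Notation "X ~> Y" := (Hom X Y) : cat_scope.
Notation "g ∘ f" := (comp g f) : cat_scope.

(* Not assumed strict. [⊗] acts on objects and [⊠] on morphisms. *)
Record symmetric_monoidal_category := SymmetricMonoidalCategory {
  smc_cat :> category;
  tensor : smc_cat -> smc_cat -> smc_cat
    where "X ⊗ Y" := (tensor X Y) : cat_scope;
  tensorm : forall X X' Y Y' : smc_cat,
      (X ~> X') -> (Y ~> Y') -> (X ⊗ Y ~> X' ⊗ Y')
    where "f ⊠ g" := (tensorm f g) : cat_scope;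
  tensorm_id : forall X Y : smc_cat, idm X ⊠ idm Y = idm (X ⊗ Y);
  tensorm_comp : forall (X X' X'' Y Y' Y'' : smc_cat)
      (f' : X' ~> X'') (f : X ~> X') (g' : Y' ~> Y'') (g : Y ~> Y'),
    (f' ∘ f) ⊠ (g' ∘ g) = (f' ⊠ g') ∘ (f ⊠ g);

  unit_ob : smc_cat;

  assoc : forall X Y Z : smc_cat, (X ⊗ Y) ⊗ Z ~> X ⊗ (Y ⊗ Z);
  assoc_inv : forall X Y Z : smc_cat, X ⊗ (Y ⊗ Z) ~> (X ⊗ Y) ⊗ Z;
  assocK : forall X Y Z : smc_cat, assoc_inv X Y Z ∘ assoc X Y Z = idm _;
  assoc_invK : forall X Y Z : smc_cat, assoc X Y Z ∘ assoc_inv X Y Z = idm _;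
  assoc_nat : forall (X X' Y Y' Z Z' : smc_cat)
      (f : X ~> X') (g : Y ~> Y') (h : Z ~> Z'),
    assoc X' Y' Z' ∘ ((f ⊠ g) ⊠ h) = (f ⊠ (g ⊠ h)) ∘ assoc X Y Z;

  lunit : forall X : smc_cat, unit_ob ⊗ X ~> X;
  lunit_inv : forall X : smc_cat, X ~> unit_ob ⊗ X;
  lunitK : forall X : smc_cat, lunit_inv X ∘ lunit X = idm _;
  lunit_invK : forall X : smc_cat, lunit X ∘ lunit_inv X = idm _;
  lunit_nat : forall (X Y : smc_cat) (f : X ~> Y),
    lunit Y ∘ (idm unit_ob ⊠ f) = f ∘ lunit X;

  runit : forall X : smc_cat, X ⊗ unit_ob ~> X;
  runit_inv : forall X : smc_cat, X ~> X ⊗ unit_ob;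
  runitK : forall X : smc_cat, runit_inv X ∘ runit X = idm _;
  runit_invK : forall X : smc_cat, runit X ∘ runit_inv X = idm _;
  runit_nat : forall (X Y : smc_cat) (f : X ~> Y),
    runit Y ∘ (f ⊠ idm unit_ob) = f ∘ runit X;

  pentagon : forall W X Y Z : smc_cat,
    assoc W X (Y ⊗ Z) ∘ assoc (W ⊗ X) Y Z
    = (idm W ⊠ assoc X Y Z) ∘ assoc W (X ⊗ Y) Z ∘ (assoc W X Y ⊠ idm Z);
  triangle : forall X Y : smc_cat,
    (idm X ⊠ lunit Y) ∘ assoc X unit_ob Y = runit X ⊠ idm Y;

  swap : forall X Y : smc_cat, X ⊗ Y ~> Y ⊗ X;
  swapK : forall X Y : smc_cat, swap Y X ∘ swap X Y = idm _;
  swap_nat : forall (X X' Y Y' : smc_cat) (f : X ~> X') (g : Y ~> Y'),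
    swap X' Y' ∘ (f ⊠ g) = (g ⊠ f) ∘ swap X Y;
  hexagon : forall X Y Z : smc_cat,
    assoc Y Z X ∘ swap X (Y ⊗ Z) ∘ assoc X Y Z
    = (idm Y ⊠ swap X Z) ∘ assoc Y X Z ∘ (swap X Y ⊠ idm Z)
}.
Arguments unit_ob {_}.
Arguments assoc {_} X Y Z.
Arguments assoc_inv {_} X Y Z.
Arguments lunit {_} X.
Arguments lunit_inv {_} X.
Arguments runit {_} X.
Arguments runit_inv {_} X.
Arguments swap {_} X Y.
Notation "X ⊗ Y" := (tensor X Y) : cat_scope.
Notation "f ⊠ g" := (tensorm f g) : cat_scope.

Definition middle_swap (C : symmetric_monoidal_category) (X X' Y Y' : C) :
    (X ⊗ X') ⊗ (Y ⊗ Y') ~> (X ⊗ Y) ⊗ (X' ⊗ Y') :=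
  assoc_inv X Y (X' ⊗ Y')
  ∘ (idm X ⊠ (assoc Y X' Y' ∘ (swap X' Y ⊠ idm Y') ∘ assoc_inv X' Y Y'))
  ∘ assoc X X' (Y ⊗ Y').
Arguments middle_swap {_} X X' Y Y'.

Record markov_category := MarkovCategory {
  mkv_smc :> symmetric_monoidal_category;
  copy : forall X : mkv_smc, X ~> X ⊗ X;
  del : forall X : mkv_smc, X ~> unit_ob;
  copyA : forall X : mkv_smc,
    assoc X X X ∘ (copy X ⊠ idm X) ∘ copy X = (idm X ⊠ copy X) ∘ copy X;
  copy_dell : forall X : mkv_smc,
    lunit X ∘ (del X ⊠ idm X) ∘ copy X = idm X;
  copy_delr : forall X : mkv_smc,
    runit X ∘ (idm X ⊠ del X) ∘ copy X = idm X;
  copyC : forall X : mkv_smc, swap X X ∘ copy X = copy X;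
  (* I ⊗ I ≅ I is the left unitor at I; it equals the right unitor at I. *)
  del_tensor : forall X Y : mkv_smc,
    del (X ⊗ Y) = lunit unit_ob ∘ (del X ⊠ del Y);
  copy_tensor : forall X Y : mkv_smc,
    copy (X ⊗ Y) = middle_swap X X Y Y ∘ (copy X ⊠ copy Y);
  del_nat : forall (X Y : mkv_smc) (f : X ~> Y), del Y ∘ f = del X
}.
Arguments copy {_} X.
Arguments del {_} X.

Definition deterministic (C : markov_category) (X Y : C) (f : X ~> Y) : Prop :=
  copy Y ∘ f = (f ⊠ f) ∘ copy X.

(* A subcategory with all the objects of C is determined by its morphisms. *)
Record wide_subcategory (C : category) := WideSubcategory {
  wsub_mem : forall X Y : C, (X ~> Y) -> Prop;
  wsub_id : forall X : C, wsub_mem (idm X);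
  wsub_comp : forall (X Y Z : C) (g : Y ~> Z) (f : X ~> Y),
    wsub_mem g -> wsub_mem f -> wsub_mem (g ∘ f)
}.
Arguments wsub_mem {C} w {X Y} f.
Notation "f ∈ D" := (wsub_mem D f) : cat_scope.

Lemma deterministic_id (C : markov_category) (X : C) : deterministic (idm X).
Proof. by rewrite /deterministic tensorm_id comp_idl comp_idr. Qed.

Lemma deterministic_comp (C : markov_category) (X Y Z : C)
    (g : Y ~> Z) (f : X ~> Y) :
  deterministic g -> deterministic f -> deterministic (g ∘ f).
Proof.
by rewrite /deterministic => dg df; rewrite compA dg -compA df compA -tensorm_comp.
Qed.

Definition Cdet (C : markov_category) : wide_subcategory C :=
  WideSubcategory (@deterministic_id C) (@deterministic_comp C).

(* Main.v *)
(** No coherence beyond Kelly's two unitor identities is needed, because every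
    structure map can be recovered from copying and marginalization.  The maps
    [copy X] and [del X] are deterministic by the comonoid laws and the
    terminality of [I].  The inverse unitors are [(del X ⊠ idm X) ∘ copy X] and
    [(idm X ⊠ del X) ∘ copy X], hence deterministic, and the inverse of a
    deterministic isomorphism is deterministic.  So the marginalizations
    [fstm : X ⊗ Y ~> X] and [sndm : X ⊗ Y ~> Y] are deterministic, and
    [swap X Y = (sndm ⊠ fstm) ∘ copy (X ⊗ Y)],
    [assoc X Y Z = ((fstm ∘ fstm) ⊠ (sndm ⊠ idm Z)) ∘ copy ((X ⊗ Y) ⊗ Z)]. *)
From Corelib Require Import ssreflect.
Require Import Defs.

Set Implicit Arguments.
Unset Strict Implicit.
Unset Printing Implicit Defensive.

Local Open Scope cat_scope.

Lemma split_epi_cancel (C : category) (X Y Z : C) (e : X ~> Y) (s : Y ~> X)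
    (f g : Y ~> Z) :
  e ∘ s = idm Y -> f ∘ e = g ∘ e -> f = g.
Proof. by move=> es fg; rewrite -(comp_idr f) -(comp_idr g) -es !compA fg. Qed.

Lemma split_mono_cancel (C : category) (X Y Z : C) (m : Y ~> Z) (r : Z ~> Y)
    (f g : X ~> Y) :
  r ∘ m = idm Y -> m ∘ f = m ∘ g -> f = g.
Proof. by move=> rm fg; rewrite -(comp_idl f) -(comp_idl g) -rm -!compA fg. Qed.

Section SymmetricMonoidal.
Variable C : symmetric_monoidal_category.
Implicit Types X Y Z : C.

Lemma tensorm_compl X Y Z W (g : Y ~> Z) (f : X ~> Y) :
  (g ∘ f) ⊠ idm W = (g ⊠ idm W) ∘ (f ⊠ idm W).
Proof. by rewrite -tensorm_comp comp_idl. Qed.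

Lemma tensorm_compr X Y Z W (g : Y ~> Z) (f : X ~> Y) :
  idm W ⊠ (g ∘ f) = (idm W ⊠ g) ∘ (idm W ⊠ f).
Proof. by rewrite -tensorm_comp comp_idl. Qed.

(** Naturality of [lunit] makes tensoring with [unit_ob] isomorphic to the identity functor. *)
Lemma tensor_unitl_faithful X Y (f g : X ~> Y) :
  idm unit_ob ⊠ f = idm unit_ob ⊠ g -> f = g.
Proof.
move=> fg; apply: (split_epi_cancel (lunit_invK X)).
by rewrite -!lunit_nat fg.
Qed.

Lemma tensor_unitr_faithful X Y (f g : X ~> Y) :
  f ⊠ idm unit_ob = g ⊠ idm unit_ob -> f = g.
Proof.
move=> fg; apply: (split_epi_cancel (runit_invK X)).
by rewrite -!runit_nat fg.
Qed.

(** Kelly's argument: after tensoring with [unit_ob] on the left and cancelling associators, this is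
    the pentagon at [unit_ob, unit_ob, X, Y] combined with two triangles. *)
Lemma lunit_tensor X Y :
  lunit (X ⊗ Y) ∘ assoc unit_ob X Y = lunit X ⊠ idm Y.
Proof.
apply: tensor_unitl_faithful; rewrite tensorm_compr.
apply: (split_epi_cancel (assoc_invK _ _ _)).
(* Precomposing with this split epi supplies the last factor of the pentagon. *)
have eK : (assoc unit_ob unit_ob X ⊠ idm Y)
    ∘ (assoc_inv unit_ob unit_ob X ⊠ idm Y) = idm _.
  by rewrite -tensorm_compl assoc_invK tensorm_id.
apply: (split_epi_cancel eK).
rewrite -assoc_nat -[RHS]compA -tensorm_compl triangle assoc_nat tensorm_id.
by rewrite -triangle -!compA (compA (idm _ ⊠ _) (assoc _ _ _)) -pentagon.
Qed.

(** Mirror image of [lunit_tensor], with the pentagon at [X, Y, unit_ob, unit_ob]. *)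
Lemma runit_tensor X Y :
  (idm X ⊠ runit Y) ∘ assoc X Y unit_ob = runit (X ⊗ Y).
Proof.
apply: tensor_unitr_faithful; rewrite tensorm_compl.
apply: (split_mono_cancel (assocK _ _ _)).
rewrite compA assoc_nat -triangle tensorm_compr.
rewrite -!compA (compA (idm _ ⊠ _) (assoc _ _ _)) -pentagon compA -assoc_nat.
by rewrite -compA tensorm_id triangle.
Qed.

Lemma middle_swap_nat (X X' Y Y' Z Z' W W' : C) (f : X ~> Z) (f' : X' ~> Z')
    (g : Y ~> W) (g' : Y' ~> W') :
  middle_swap Z Z' W W' ∘ ((f ⊠ f') ⊠ (g ⊠ g'))
  = ((f ⊠ g) ⊠ (f' ⊠ g')) ∘ middle_swap X X' Y Y'.
Proof.
have assoc_inv_nat (A A' B B' D D' : C) (a : A ~> A') (b : B ~> B')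
    (d : D ~> D') :
    assoc_inv A' B' D' ∘ (a ⊠ (b ⊠ d)) = ((a ⊠ b) ⊠ d) ∘ assoc_inv A B D.
  apply: (split_mono_cancel (assocK A' B' D')).
  by rewrite !compA assoc_nat assoc_invK comp_idl -compA assoc_invK comp_idr.
rewrite /middle_swap -compA assoc_nat !compA -assoc_inv_nat.
congr (_ ∘ _); rewrite -!compA -!tensorm_comp comp_idl comp_idr.
congr (_ ∘ (_ ⊠ _)).
rewrite -!compA assoc_inv_nat !compA -assoc_nat.
by rewrite -!(compA (assoc _ _ _)) -!tensorm_comp swap_nat comp_idl comp_idr.
Qed.

(** The two Kelly identities move the outer units past the associators, so that only the inner
    symmetry survives. *)
Lemma middle_swap_swap X Y :
  (lunit Y ⊠ runit X) ∘ middle_swap unit_ob X Y unit_ob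
  = swap X Y ∘ (lunit X ⊠ runit Y).
Proof.
rewrite /middle_swap.
have lr (A B : C) :
    (lunit B ⊠ runit A) ∘ assoc_inv unit_ob B (A ⊗ unit_ob)
    = (idm B ⊠ runit A) ∘ lunit (B ⊗ (A ⊗ unit_ob)).
  apply: (split_epi_cancel (assoc_invK _ _ _)).
  by rewrite -!compA assocK comp_idr lunit_tensor -tensorm_comp comp_idl comp_idr.
have r_inv : runit (X ⊗ Y) ∘ assoc_inv X Y unit_ob = idm X ⊠ runit Y.
  by rewrite -runit_tensor -compA assoc_invK comp_idr.
rewrite !compA lr -(compA (idm Y ⊠ runit X)) lunit_nat -!compA lunit_tensor.
rewrite !compA runit_tensor runit_nat -(compA (swap X Y)) r_inv -compA.
by rewrite -tensorm_comp comp_idl comp_idr.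
Qed.

End SymmetricMonoidal.

Section Markov.
Variable C : markov_category.
Implicit Types X Y Z : C.

(* [del_nat] alone makes [del unit_ob] an absorbing idempotent, not an
   identity: counitality is what makes it left-invertible. *)
Lemma del_unit : del (unit_ob : C) = idm unit_ob.
Proof.
set e := del _.
have e_conj : e ⊠ idm unit_ob = runit_inv unit_ob ∘ e ∘ runit unit_ob.
  by rewrite -compA -runit_nat compA runitK comp_idl.
have eK : lunit unit_ob ∘ runit_inv unit_ob ∘ e = idm _.
  rewrite -[RHS](copy_dell (unit_ob : C)) e_conj -!compA.
  by rewrite !del_nat.
by rewrite -[LHS]comp_idl -eK -compA del_nat.
Qed.

Lemma unit_terminal X (f g : X ~> unit_ob) : f = g.
Proof. by rewrite -(comp_idl f) -(comp_idl g) -del_unit !del_nat. Qed.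

Lemma lunit_invE X : lunit_inv X = (del X ⊠ idm X) ∘ copy X.
Proof.
apply: (split_mono_cancel (lunitK X)).
by rewrite lunit_invK compA copy_dell.
Qed.

Lemma runit_invE X : runit_inv X = (idm X ⊠ del X) ∘ copy X.
Proof.
apply: (split_mono_cancel (runitK X)).
by rewrite runit_invK compA copy_delr.
Qed.

(** Cocommutativity exchanges the copying formulas for the two inverse unitors. *)
Lemma lunit_swap X : lunit X ∘ swap X unit_ob = runit X.
Proof.
apply: (split_epi_cancel (runitK X)).
by rewrite runit_invK runit_invE -compA (compA (swap _ _)) swap_nat
  -(compA (_ ⊠ _)) copyC compA copy_dell.
Qed.

Definition fstm X Y : X ⊗ Y ~> X := runit X ∘ (idm X ⊠ del Y).
Definition sndm X Y : X ⊗ Y ~> Y := lunit Y ∘ (del X ⊠ idm Y).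

(** Deleting commutes past [middle_swap] and turns the two copies into inverse unitors;
    [middle_swap_swap] then applies. *)
Lemma swapE X Y : swap X Y = (sndm X Y ⊠ fstm X Y) ∘ copy (X ⊗ Y).
Proof.
rewrite /sndm /fstm tensorm_comp copy_tensor -compA (compA ((_ ⊠ _) ⊠ _)).
rewrite -middle_swap_nat -(compA (middle_swap _ _ _ _)) -tensorm_comp.
rewrite -lunit_invE -runit_invE compA middle_swap_swap -compA -tensorm_comp.
by rewrite lunit_invK runit_invK tensorm_id comp_idr.
Qed.

Lemma pair_projections X Y : (fstm X Y ⊠ sndm X Y) ∘ copy (X ⊗ Y) = idm _.
Proof. by rewrite -(copyC (X ⊗ Y)) compA -swap_nat -compA -swapE swapK. Qed.

(** Expanding [copy] on the outer tensor, [pair_projections] collapses the [X ⊗ Y] half and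
    counitality the [Z] half. What remains is a [middle_swap] with one unit slot, which the triangle
    and unitor identities reduce to [assoc]. *)
Lemma assocE X Y Z :
  assoc X Y Z
  = ((fstm X Y ∘ fstm (X ⊗ Y) Z) ⊠ (sndm X Y ⊠ idm Z)) ∘ copy ((X ⊗ Y) ⊗ Z).
Proof.
(* A unitor after a single tensor is the shape that [middle_swap_nat] can act on. *)
have -> : fstm X Y ∘ fstm (X ⊗ Y) Z = runit X ∘ (fstm X Y ⊠ del Z).
  rewrite {2}/fstm compA -runit_nat -compA -tensorm_comp.
  by rewrite comp_idl comp_idr.
rewrite -[sndm X Y ⊠ idm Z]comp_idl tensorm_comp copy_tensor.
rewrite -compA (compA ((_ ⊠ _) ⊠ _)) -middle_swap_nat.
rewrite -(compA (middle_swap _ _ _ _)) -tensorm_comp.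
rewrite pair_projections -lunit_invE /middle_swap.
have runit_assoc (A B D : C) :
    (runit A ⊠ idm (B ⊗ D)) ∘ assoc_inv A unit_ob (B ⊗ D)
    = idm A ⊠ lunit (B ⊗ D).
  by rewrite -triangle -compA assoc_invK comp_idr.
rewrite !compA runit_assoc -tensorm_compr !compA lunit_tensor -tensorm_compl.
rewrite lunit_swap -triangle -(compA (idm Y ⊠ _)) assoc_invK comp_idr.
rewrite -tensorm_id -compA assoc_nat compA -!tensorm_compr lunit_invK.
by rewrite !tensorm_id comp_idl.
Qed.

Lemma deterministic_tensor (X X' Y Y' : C) (f : X ~> X') (g : Y ~> Y') :
  deterministic f -> deterministic g -> deterministic (f ⊠ g).
Proof.
rewrite /deterministic => df dg.
rewrite !copy_tensor -compA -tensorm_comp df dg tensorm_comp.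
by rewrite compA middle_swap_nat -compA.
Qed.

Lemma deterministic_inverse X Y (f : X ~> Y) (g : Y ~> X) :
  g ∘ f = idm X -> f ∘ g = idm Y -> deterministic f -> deterministic g.
Proof.
rewrite /deterministic => gf fg df; apply: (split_epi_cancel fg).
by rewrite -!compA gf df comp_idr compA -tensorm_comp gf tensorm_id comp_idl.
Qed.

(** The common target [unit_ob ⊗ unit_ob] is isomorphic to the terminal object. *)
Lemma deterministic_del X : deterministic (del X).
Proof. by apply: (split_mono_cancel (lunitK _)); apply: unit_terminal. Qed.

(** The claim is that fourfold copying is invariant under exchanging the two middle outputs.
    Coassociativity makes these the outputs of one [copy], where cocommutativity absorbs the
    swap. *)
Lemma deterministic_copy X : deterministic (copy X).
Proof.
have copy4 : assoc X X (X ⊗ X) ∘ ((copy X ⊠ copy X) ∘ copy X)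
    = (idm X ⊠ ((idm X ⊠ copy X) ∘ copy X)) ∘ copy X.
  have -> : copy X ⊠ copy X = ((idm X ⊠ idm X) ⊠ copy X) ∘ (copy X ⊠ idm X).
    by rewrite -tensorm_comp tensorm_id comp_idl comp_idr.
  by rewrite !compA assoc_nat -!compA (compA (assoc _ _ _)) copyA
    tensorm_compr -compA.
rewrite /deterministic copy_tensor /middle_swap -!compA copy4.
apply: (split_mono_cancel (assocK _ _ _)).
rewrite copy4 !compA assoc_invK comp_idl -tensorm_comp comp_idl.
(* The first output splits off, leaving a threefold copy with its first two outputs exchanged. *)
congr ((_ ⊠ _) ∘ _).
rewrite -copyA -!compA (compA (assoc_inv _ _ _)) assocK comp_idl.
by rewrite (compA (swap _ _ ⊠ _)) -tensorm_compl copyC.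
Qed.

Lemma deterministic_lunit_inv X : deterministic (lunit_inv X).
Proof.
rewrite lunit_invE; apply: deterministic_comp (deterministic_copy X).
exact: deterministic_tensor (deterministic_del X) (deterministic_id X).
Qed.

Lemma deterministic_runit_inv X : deterministic (runit_inv X).
Proof.
rewrite runit_invE; apply: deterministic_comp (deterministic_copy X).
exact: deterministic_tensor (deterministic_id X) (deterministic_del X).
Qed.

Lemma deterministic_lunit X : deterministic (lunit X).
Proof.
exact: deterministic_inverse (lunit_invK X) (lunitK X)
  (deterministic_lunit_inv X).
Qed.

Lemma deterministic_runit X : deterministic (runit X).
Proof.
exact: deterministic_inverse (runit_invK X) (runitK X)
  (deterministic_runit_inv X).
Qed.

Lemma deterministic_fstm X Y : deterministic (fstm X Y).
Proof.
apply: deterministic_comp (deterministic_runit X) _.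
exact: deterministic_tensor (deterministic_id X) (deterministic_del Y).
Qed.

Lemma deterministic_sndm X Y : deterministic (sndm X Y).
Proof.
apply: deterministic_comp (deterministic_lunit Y) _.
exact: deterministic_tensor (deterministic_del X) (deterministic_id Y).
Qed.

Lemma deterministic_swap X Y : deterministic (swap X Y).
Proof.
rewrite swapE; apply: deterministic_comp (deterministic_copy _).
exact: deterministic_tensor (deterministic_sndm X Y) (deterministic_fstm X Y).
Qed.

Lemma deterministic_assoc X Y Z : deterministic (assoc X Y Z).
Proof.
rewrite assocE; apply: deterministic_comp (deterministic_copy _).
apply: deterministic_tensor.
  exact: deterministic_comp (deterministic_fstm _ _) (deterministic_fstm _ _).
exact: deterministic_tensor (deterministic_sndm X Y) (deterministic_id Z).
Qed.

End Markov.

Theorem lemma10p12 (C : markov_category) :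
  (forall (X X' Y Y' : C) (f : X ~> X') (g : Y ~> Y'),
     f ∈ Cdet C -> g ∈ Cdet C -> f ⊠ g ∈ Cdet C) /\
  (forall X Y Z : C, assoc X Y Z ∈ Cdet C /\ assoc_inv X Y Z ∈ Cdet C) /\
  (forall X : C, lunit X ∈ Cdet C /\ lunit_inv X ∈ Cdet C) /\
  (forall X : C, runit X ∈ Cdet C /\ runit_inv X ∈ Cdet C) /\
  (forall X : C, del X ∈ Cdet C) /\
  (forall X : C, copy X ∈ Cdet C) /\
  (forall X Y : C, swap X Y ∈ Cdet C).
Proof.
split; first exact: deterministic_tensor.
split=> [X Y Z|].
  have det_assoc := deterministic_assoc X Y Z; split; first exact: det_assoc.
  exact: deterministic_inverse (assocK X Y Z) (assoc_invK X Y Z) det_assoc.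
split=> [X|].
  by split; [exact: deterministic_lunit | exact: deterministic_lunit_inv].
split=> [X|].
  by split; [exact: deterministic_runit | exact: deterministic_runit_inv].
split; first exact: deterministic_del.
by split; [exact: deterministic_copy | exact: deterministic_swap].
Qed.
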